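(* Let $a\in\mathcal{A}$ and let $m\geq 1$ be an integer. The following are equivalent: (1) $a$ has an $m$-generalized right group inverse. (2) There exists an idempotent $p\in\mathcal{A}$ such that $(1-p)a(1-p)$ is right invertible in the ring $(1-p)\mathcal{A}(1-p)$ (with identity $1-p$), $\big((a^m)^*a^{m}p\big)^*=(a^m)^*a^{m}p$, $ap\in\mathcal{A}^{qnil}$, and $(1-p)\mathcal{A}=a(1-p)\mathcal{A}$.
   Context: $\mathcal{A}$ is a unital complex Banach *-algebra, i.e. a Banach algebra with an involution $*$ satisfying $(x+y)^*=x^*+y^*$, $(\lambda x)^*=\overline{\lambda}x^*$, $(xy)^*=y^*x^*$, $(x^* )^*=x$; the involution is assumed proper: $x^*x=0$ implies $x=0$. $\mathcal{A}^{qnil}=\{x\in\mathcal{A}: \lim_{n\to\infty}\|x^n\|^{1/n}=0\}$. An element $d\in\mathcal{A}$ is a generalized right Drazin inverse of $a$ if $ad^2=d$, $a^2d=ada$ and $a-ada\in\mathcal{A}^{qnil}$ (it need not be unique). An element $x\in\mathcal{A}$ is an $m$-generalized right group inverse of $a$ if there is a generalized right Drazin inverse $d$ of $a$ such that $x=ax^2$, $(ad)^*a^{m+1}x=(ad)^*a^m$ and $\lim_{n\to\infty}\|a^n-axa^n\|^{1/n}=0$. *)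

(* Defs.v *)
From HB Require Import structures.
From mathcomp Require Import all_boot all_order all_algebra.
From mathcomp Require Import all_classical all_reals all_analysis.
From mathcomp Require Import complex.

Set Implicit Arguments.
Unset Strict Implicit.
Unset Printing Implicit Defensive.

Import Order.TTheory GRing.Theory Num.Theory.
Import numFieldNormedType.Exports.

Local Open Scope classical_set_scope.
Local Open Scope ring_scope.

(* The library has no common ancestor of rings and normed modules below
   numDomainType, so the product is introduced on top of the normed module, and
   the library ring and algebra structures are derived from it just below.
   No normalization `|1| = 1 is assumed. *)
HB.mixin Record CompleteNormedModule_isBanachAlgebra (R : realType) A
    & CompleteNormedModule R[i] A := {
  banach_one : A ;
  banach_mul : A -> A -> A ;
  banach_mulA : forall x y z : A,
    banach_mul x (banach_mul y z) = banach_mul (banach_mul x y) z ;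
  banach_mul1l : forall x : A, banach_mul banach_one x = x ;
  banach_mul1r : forall x : A, banach_mul x banach_one = x ;
  banach_mulDl : forall x y z : A,
    banach_mul (x + y) z = banach_mul x z + banach_mul y z ;
  banach_mulDr : forall x y z : A,
    banach_mul x (y + z) = banach_mul x y + banach_mul x z ;
  banach_one_neq0 : banach_one != 0 ;
  banach_scaleAl : forall (l : R[i]) (x y : A),
    l *: banach_mul x y = banach_mul (l *: x) y ;
  banach_scaleAr : forall (l : R[i]) (x y : A),
    l *: banach_mul x y = banach_mul x (l *: y) ;
  banach_normM : forall x y : A, `|banach_mul x y| <= `|x| * `|y|
}.

#[short(type="banachAlgType")]
HB.structure Definition BanachAlgebra (R : realType) :=
  {A of CompleteNormedModule R[i] A & CompleteNormedModule_isBanachAlgebra R A}.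

HB.instance Definition _ (R : realType) (A : banachAlgType R) :=
  GRing.Zmodule_isNzRing.Build (BanachAlgebra.sort A)
    (@banach_mulA R A) (@banach_mul1l R A) (@banach_mul1r R A)
    (@banach_mulDl R A) (@banach_mulDr R A) (@banach_one_neq0 R A).

HB.instance Definition _ (R : realType) (A : banachAlgType R) :=
  GRing.Lmodule_isLalgebra.Build R[i] (BanachAlgebra.sort A)
    (@banach_scaleAl R A).

HB.instance Definition _ (R : realType) (A : banachAlgType R) :=
  GRing.Lalgebra_isAlgebra.Build R[i] (BanachAlgebra.sort A)
    (@banach_scaleAr R A).

HB.mixin Record BanachAlgebra_hasProperInvolution (R : realType) A
    & BanachAlgebra R A := {
  star : A -> A ;
  starD : forall x y : A, star (x + y) = star x + star y ;
  starZ : forall (l : R[i]) (x : A), star (l *: x) = Num.conj l *: star x ;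
  starM : forall x y : A, star (banach_mul x y) = banach_mul (star y) (star x) ;
  starK : forall x : A, star (star x) = x ;
  star_proper : forall x : A, banach_mul (star x) x = 0 -> x = 0
}.

#[short(type="banachStarAlgType")]
HB.structure Definition BanachStarAlgebra (R : realType) :=
  {A of BanachAlgebra R A & BanachAlgebra_hasProperInvolution R A}.

HB.instance Definition _ (R : realType) (A : banachStarAlgType R) :=
  GRing.Algebra.copy (BanachStarAlgebra.sort A) (BanachAlgebra.sort A).

Section BanachStarAlgebraDefs.
Context {R : realType} {A : banachStarAlgType R}.
Implicit Types a b d p q x : A.

(* The norm of a module over R[i] is valued in the nonnegative reals of R[i];
   this is the same number as an element of R. *)
Definition rnorm x : R := complex.Re `|x|.

Definition root_norm_cvg0 (u : nat -> A) : Prop :=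
  (fun n : nat => rnorm (u n) `^ (n%:R)^-1) @ \oo --> (0 : R).

Definition qnil : set A := [set x | root_norm_cvg0 (fun n => x ^+ n)].

Definition gen_right_drazin_inverse a d : Prop :=
  [/\ a * d ^+ 2 = d, a ^+ 2 * d = a * d * a & qnil (a - a * d * a)].

Definition gen_right_group_inverse (m : nat) a x : Prop :=
  exists2 d, gen_right_drazin_inverse a d &
    [/\ x = a * x ^+ 2,
        star (a * d) * a ^+ m.+1 * x = star (a * d) * a ^+ m &
        root_norm_cvg0 (fun n => a ^+ n - a * x * a ^+ n)].

Definition right_ideal b : set A := range (fun z => b * z).

Definition corner q : set A := range (fun z => q * z * q).

(* For q idempotent, q is the identity of the ring q A q. *)
Definition corner_right_invertible q b : Prop :=
  corner q b /\ exists2 c, corner q c & b * c = q.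

End BanachStarAlgebraDefs.

(* Main.v *)
(* From an m-generalized right group inverse x of a, take p = 1 - a x.
   Conversely, let q = 1 - p and let c be a right inverse of q a q in q A q.
   Then x = c works; the difficulty is to find the generalized right Drazin
   inverse d.  The series s = sum_n c^(n+1) a p a^n converges because p a is
   quasinilpotent, and e = q + s is an idempotent commuting with a such that
   a (1 - e) is quasinilpotent; then d = c e satisfies a d = e. *)

Require Import Defs.
From HB Require Import structures.
From mathcomp Require Import all_boot all_order all_algebra.
From mathcomp Require Import all_classical all_reals all_analysis.
From mathcomp Require Import complex.

Set Implicit Arguments.
Unset Strict Implicit.
Unset Printing Implicit Defensive.

Import Order.TTheory GRing.Theory Num.Theory.
Import numFieldNormedType.Exports.

Local Open Scope classical_set_scope.
Local Open Scope ring_scope.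

Section RootNorm.
Context {R : realType} {A : banachStarAlgType R}.
Implicit Types (u v : nat -> A) (x y : A).

(** * The real-valued norm *)

Lemma rnormE x : `|x| = (rnorm x)%:C%C.
Proof. by rewrite RRe_real// normr_real. Qed.

Lemma rnorm_ge0 x : 0 <= rnorm x.
Proof. by rewrite -lecR -rnormE rmorph0. Qed.

Lemma rnorm0_eq0 x : rnorm x = 0 -> x = 0.
Proof. by move=> x0; apply/normr0_eq0; rewrite rnormE x0 rmorph0. Qed.

Lemma rnormM x y : rnorm (x * y) <= rnorm x * rnorm y.
Proof. by rewrite -lecR rmorphM/= -!rnormE; exact: banach_normM. Qed.

Lemma rnormX x n : rnorm (x ^+ n) <= rnorm (1 : A) * rnorm x ^+ n.
Proof.
elim: n => [|n IH]; first by rewrite !expr0 mulr1.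
rewrite !exprSr; apply: le_trans (rnormM _ _) _.
by rewrite mulrA ler_wpM2r// rnorm_ge0.
Qed.

(** * Root decay as domination by every geometric sequence *)

Lemma le_expr2_near (C : R) : \forall n \near \oo, C <= 2 ^+ n.
Proof.
near=> n; apply: (@le_trans _ _ n%:R); last first.
  by rewrite -natrX ler_nat ltnW// ltn_expl.
near: n; exact: nbhs_infty_ger.
Unshelve. all: by end_near. Qed.

(** Trades [n]-th roots for geometric bounds; the constant [C] absorbs any finite set of indices, in
    particular the degenerate root at [n = 0]. *)
Lemma root_norm_cvg0P u : root_norm_cvg0 u <->
  forall e : R, 0 < e -> exists C, forall n, rnorm (u n) <= C * e ^+ n.
Proof.
split=> [u0 e e0|ule].
  have := cvgr0_norm_lt _ u0 _ e0.
  (* The sum serves the indices up to [N]; the summand 1 serves the later ones, where the root is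
     already below [e]. *)
  move=> [N _ Nu]; pose C := 1 + \sum_(k < N.+1) rnorm (u k) / e ^+ k.
  have t0 k : 0 <= rnorm (u k) / e ^+ k.
    by rewrite divr_ge0 ?rnorm_ge0 ?exprn_ge0 ?ltW.
  exists C => n; have [nN|Nn] := ltnP n N.+1.
    rewrite -ler_pdivrMr ?exprn_gt0// /C (bigD1 (Ordinal nN))//= addrCA.
    by rewrite lerDl addr_ge0// sumr_ge0.
  apply: (@le_trans _ _ (e ^+ n)); last first.
    by rewrite ler_peMl ?exprn_ge0 ?(ltW e0)// /C lerDl sumr_ge0.
  have := Nu n (ltnW Nn); rewrite /= ger0_norm ?powR_ge0// => /ltW un.
  have n0 : n%:R != 0 :> R by rewrite pnatr_eq0 -lt0n (leq_trans _ Nn).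
  have -> : rnorm (u n) = (rnorm (u n) `^ n%:R^-1) ^+ n.
    by rewrite -powR_mulrn ?powR_ge0// -powRrM mulVf// powRr1// rnorm_ge0.
  by rewrite lerXn2r// nnegrE ?powR_ge0// ltW.
apply/cvgr0Pnorm_le => e e0.
(* Asking for the rate [e / 2] leaves a factor [2 ^+ n], which eventually exceeds [C]. *)
have [|C Cu] := ule (e / 2); first by rewrite divr_gt0.
near=> n; rewrite ger0_norm ?powR_ge0//.
have n0 : n%:R != 0 :> R by rewrite pnatr_eq0 -lt0n; near: n; exists 1%N.
have -> : e = (e ^+ n) `^ n%:R^-1.
  by rewrite -powR_mulrn ?(ltW e0)// -powRrM mulfV// powRr1// ltW.
rewrite ge0_ler_powR ?nnegrE ?invr_ge0 ?rnorm_ge0 ?exprn_ge0 ?(ltW e0)//.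
apply: le_trans (Cu n) _; rewrite expr_div_n mulrCA.
rewrite ler_piMr ?exprn_ge0 ?(ltW e0)//.
rewrite ler_pdivrMr ?exprn_gt0// mul1r.
by near: n; exact: le_expr2_near.
Unshelve. all: by end_near. Qed.

Lemma root_norm_cvg0_le u v (K M : R) : 0 < M -> root_norm_cvg0 u ->
  (forall n, rnorm (v n) <= K * M ^+ n * rnorm (u n)) -> root_norm_cvg0 v.
Proof.
move=> M0 /root_norm_cvg0P u0 vu; apply/root_norm_cvg0P => e e0.
have [C Cu] := u0 (e / M) (divr_gt0 e0 M0).
exists (`|K| * C) => n; apply: le_trans (vu n) _.
apply: (@le_trans _ _ (`|K| * M ^+ n * rnorm (u n))).
  rewrite ler_wpM2r ?rnorm_ge0// ler_wpM2r ?ler_norm//.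
  by rewrite exprn_ge0// ltW.
rewrite -!mulrA ler_wpM2l// mulrC -ler_pdivlMr ?exprn_gt0//.
by rewrite -mulrA -expr_div_n.
Qed.

(** Power identities such as [(b * a) ^+ n = b * a ^+ n] may fail at [n = 0], an index that the
    limit ignores. *)
Lemma root_norm_cvg0_eqS u v : (forall n, u n.+1 = v n.+1) ->
  root_norm_cvg0 u -> root_norm_cvg0 v.
Proof.
move=> uv; apply: cvg_trans; apply: near_eq_cvg; near=> n.
have -> : n = n.-1.+1 by rewrite prednK//; near: n; exists 1%N.
by rewrite uv.
Unshelve. all: by end_near. Qed.

Lemma root_norm_cvg0_cst y : root_norm_cvg0 (fun=> y) -> y = 0.
Proof.
move=> /root_norm_cvg0P /(_ 2^-1); rewrite invr_gt0 => /(_ (ltr0Sn _ _))[C Cy].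
apply/rnorm0_eq0/eqP; apply: contraT => y0.
have {}y0 : 0 < rnorm y by rewrite lt_def y0 rnorm_ge0.
have [n _ /(_ n (leqnn _))] := le_expr2_near ((C + 1) / rnorm y).
rewrite /= ler_pdivrMr// => Cn; have := Cy n.
rewrite exprVn ler_pdivlMr ?exprn_gt0// mulrC => /(le_trans Cn).
by rewrite gerDl ler10.
Qed.

Lemma root_norm_cvg0_mul u b c : root_norm_cvg0 u ->
  root_norm_cvg0 (fun n => b * u n * c).
Proof.
move=> /(root_norm_cvg0_le (K := rnorm b * rnorm c) ltr01); apply=> n.
rewrite expr1n mulr1; apply: le_trans (rnormM _ _) _.
by rewrite mulrAC ler_wpM2r ?rnorm_ge0// rnormM.
Qed.

(** The powers of [x] and [y] grow at most geometrically, and root decay beats any geometric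
    growth. *)
Lemma root_norm_cvg0_mulX u x y : root_norm_cvg0 u ->
  root_norm_cvg0 (fun n => x ^+ n * u n * y ^+ n).
Proof.
have M0 (z : A) : 0 < rnorm z + 1 by rewrite ltr_wpDl ?rnorm_ge0.
have zX (z : A) n : rnorm (z ^+ n) <= rnorm (1 : A) * (rnorm z + 1) ^+ n.
  apply: le_trans (rnormX _ _) _; rewrite ler_wpM2l ?rnorm_ge0//.
  by rewrite lerXn2r ?nnegrE ?rnorm_ge0 ?(ltW (M0 z))// lerDl.
move=> /(root_norm_cvg0_le (K := rnorm (1 : A) * rnorm (1 : A))
  (mulr_gt0 (M0 x) (M0 y))); apply=> n.
rewrite exprMn (mulrACA (rnorm 1)) [leRHS]mulrAC.
apply: le_trans (rnormM _ _) _.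
apply: ler_pM; rewrite ?rnorm_ge0 ?zX//.
by apply: le_trans (rnormM _ _) _; rewrite ler_wpM2r ?rnorm_ge0 ?zX.
Qed.

(** Rests on [(b * a) ^+ n.+1 = b * (a * b) ^+ n * a]. *)
Lemma qnil_mulC (a b : A) : qnil (a * b) -> qnil (b * a).
Proof.
move=> /(@root_norm_cvg0_mul _ b a) /root_norm_cvg0P ab0.
apply/root_norm_cvg0P => e e0; have [C Cu] := ab0 e e0.
have baS n : (b * a) ^+ n.+1 = b * (a * b) ^+ n * a.
  elim: n => [|n IH]; first by rewrite expr1 expr0 mulr1.
  by rewrite exprS IH [in RHS]exprS !mulrA.
(* The first summand handles [n = 0]; dividing by [e] compensates the shift of the exponent. *)
exists (rnorm (1 : A) + `|C| / e) => -[|n].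
  by rewrite !expr0 mulr1 lerDl divr_ge0// ltW.
rewrite baS; apply: le_trans (Cu n) _.
rewrite mulrDl exprS [X in _ + X]mulrA divfK ?gt_eqF//.
apply: (@le_trans _ _ (`|C| * e ^+ n)).
  by rewrite ler_wpM2r ?ler_norm// exprn_ge0// ltW.
by rewrite lerDr mulr_ge0 ?rnorm_ge0// -exprS exprn_ge0// ltW.
Qed.

(** * Convergent series and limits of products *)

Lemma normed_series_cvg u : cvgn (series (rnorm \o u)) -> cvgn (series u).
Proof.
move=> /cauchy_cvgP/cauchy_seriesP u_ncvg.
apply/cauchy_cvgP/cauchy_seriesP => e e0.
have eE : e = (complex.Re e)%:C%C by rewrite RRe_real// gtr0_real.
rewrite eE ltcR in e0; have := u_ncvg _ e0; apply: filterS => n /=.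
rewrite ger0_norm ?sumr_ge0// => [|k _]; last exact: rnorm_ge0.
rewrite -ltcR -eE; apply: le_lt_trans.
rewrite rmorph_sum/= -(eq_bigr _ (fun k _ => rnormE (u k))).
exact: ler_norm_sum.
Qed.

Lemma root_norm_cvg0_series u : root_norm_cvg0 u -> cvgn (series u).
Proof.
move=> /root_norm_cvg0P /(_ 2^-1); rewrite invr_gt0 => /(_ (ltr0Sn _ _))[C Cu].
apply: normed_series_cvg.
apply: (@series_le_cvg _ _ (geometric `|C| 2^-1)) => [n|n|n|].
- exact: rnorm_ge0.
- by rewrite /= mulr_ge0// exprn_ge0// invr_ge0.
- rewrite /=; apply: le_trans (Cu n) _.
  by rewrite ler_wpM2r ?ler_norm// exprn_ge0// invr_ge0.
- apply: is_cvg_geometric_series.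
  by rewrite ger0_norm ?invr_ge0// invf_lt1// ltr1n.
Qed.

Lemma cvgn_mull u x b : u @ \oo --> x -> (fun n => b * u n) @ \oo --> b * x.
Proof.
move=> /cvgrPdist_le ux; apply/cvgrPdist_le => e e0.
have b0 : 0 < 1 + `|b| by rewrite ltr_pwDl.
have := ux (e / (1 + `|b|)) (divr_gt0 e0 b0); apply: filterS => n /=.
rewrite ler_pdivlMr// mulrC -mulrBr; apply: le_trans.
by apply: le_trans (banach_normM _ _) _; rewrite ler_wpM2r// lerDr.
Qed.

Lemma cvgn_mulr u x b : u @ \oo --> x -> (fun n => u n * b) @ \oo --> x * b.
Proof.
move=> /cvgrPdist_le ux; apply/cvgrPdist_le => e e0.
have b0 : 0 < 1 + `|b| by rewrite ltr_pwDl.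
have := ux (e / (1 + `|b|)) (divr_gt0 e0 b0); apply: filterS => n /=.
rewrite ler_pdivlMr// -mulrBl; apply: le_trans.
by apply: le_trans (banach_normM _ _) _; rewrite ler_wpM2l// lerDr.
Qed.

(** * Powers of compressed elements *)

Lemma exprS_compress (a b : A) n :
  b * a * b = b * a -> (b * a) ^+ n.+1 = b * a ^+ n.+1.
Proof.
move=> bab; elim: n => [//|n IH].
by rewrite exprS IH mulrA bab -mulrA -exprS.
Qed.

Lemma qnil_compress (a b : A) : b * a * b = b * a ->
  qnil (b * a) <-> root_norm_cvg0 (fun n => b * a ^+ n).
Proof.
by move=> bab; split; apply: root_norm_cvg0_eqS => n; rewrite exprS_compress.
Qed.

(** Each use of [x = a * x ^+ 2] cancels one [a] against one [x]. *)
Lemma mul_expr_fix (a x : A) n :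
  x = a * x ^+ 2 -> a ^+ n * (a * x ^+ n.+1) = a * x.
Proof.
move=> ax; elim: n => [|n IH]; first by rewrite expr0 mul1r.
rewrite -[in RHS]IH exprSr -!mulrA; congr (_ * (_ * _)).
by rewrite -[n.+2]/(2 + n)%N exprD mulrA -ax -exprS.
Qed.

(* [a x = a^(n+1) x^(n+1)] for all [n], so the decay of [b a^n] beats the
   geometric growth of [x^(n+1)]. *)
Lemma root_norm_cvg0_annihil (a b x : A) : x = a * x ^+ 2 ->
  root_norm_cvg0 (fun n => b * a ^+ n) -> b * (a * x) = 0.
Proof.
move=> ax b0; apply: root_norm_cvg0_cst.
have := root_norm_cvg0_mul 1 x
  (root_norm_cvg0_mulX 1 x (root_norm_cvg0_mul 1 a b0)).
apply: root_norm_cvg0_eqS => n.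
by rewrite expr1n !mul1r -(mul_expr_fix n.+1 ax) [x ^+ n.+2]exprSr !mulrA.
Qed.

(** * The involution *)

Lemma star_mul x y : star (x * y) = star y * star x.
Proof. exact: starM. Qed.

Lemma star1 : star (1 : A) = 1.
Proof. by rewrite -[LHS]mulr1 -[X in _ * X]starK -star_mul mulr1 starK. Qed.

Lemma starB x y : star (x - y) = star x - star y.
Proof. by apply: (addIr (star y)); rewrite -starD !subrK. Qed.

(** Both sides amount to [star b * b * p = star p * star b * b * p], whose right-hand side is
    self-adjoint: [b * p] and [b * (1 - p)] are orthogonal. *)
Lemma star_gram_idem (b p : A) : p * p = p ->
  star (star b * b * p) = star b * b * p <->
  star (b * (1 - p)) * (b * p) = 0.
Proof.
move=> pp; rewrite !star_mul starK starB star1 mulrBl mul1r mulrBl !mulrA.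
split=> [bp|/subr0_eq bp]; last first.
  by have := congr1 star bp; rewrite !star_mul !starK !mulrA => ->.
by rewrite bp -[X in _ - X]mulrA pp subrr.
Qed.

(** * The Sylvester equation *)

Lemma cvgn_unique u x y : u @ \oo --> x -> u @ \oo --> y -> x = y.
Proof. by move=> ux uy; apply: (cvg_unique _ ux uy); exact: norm_hausdorff. Qed.

(** The solution is the series of [c ^+ n.+1 * a * (p * a ^+ n)], which converges by the decay of
    [p * a ^+ n]. Since [a * c = q], multiplying a term on the left by [a] gives the previous term
    times [a], so the equation telescopes. *)
Lemma sylvester_solution (a c p q : A) :
  a * c = q -> q * c = c -> p * p = p -> q + p = 1 -> p * a * q = 0 ->
  root_norm_cvg0 (fun n => p * a ^+ n) ->
  exists s, [/\ q * s = s, s * p = s & a * s = q * a * p + s * a].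
Proof.
move=> ac qc pp qp paq pa0.
have paX n : p * a ^+ n * p = p * a ^+ n.
  elim: n => [|n IH]; first by rewrite expr0 mulr1.
  have pap : p * a * p = p * a by rewrite -[RHS]mulr1 -qp mulrDr paq add0r.
  by rewrite exprSr mulrA -[in LHS]IH -!mulrA [p * (a * p)]mulrA pap !mulrA IH.
pose u n := c ^+ n.+1 * a * (p * a ^+ n).
have u0 : root_norm_cvg0 u.
  have := root_norm_cvg0_mul c 1
    (root_norm_cvg0_mulX c 1 (root_norm_cvg0_mul a 1 pa0)).
  by apply: root_norm_cvg0_eqS => n; rewrite /u expr1n !mulr1 !mulrA -exprS.
have qu n : q * u n = u n by rewrite /u exprS !mulrA qc.
have up n : u n * p = u n by rewrite /u -mulrA paX.
have au0 : a * u 0 = q * a * p by rewrite /u expr1 expr0 mulr1 !mulrA ac.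
have auS n : a * u n.+1 = u n * a.
  by rewrite /u exprS !mulrA ac exprS !mulrA qc -!mulrA -exprSr.
have /cvg_ex[s us] := root_norm_cvg0_series u0.
exists s; split.
- apply: (cvgn_unique (cvgn_mull (b := q) us)).
  by under eq_fun do rewrite mulr_sumr (eq_bigr _ (fun n _ => qu n)).
- apply: (cvgn_unique (cvgn_mulr (b := p) us)).
  by under eq_fun do rewrite mulr_suml (eq_bigr _ (fun n _ => up n)).
(* The shifted partial sums let the first term split off as [q * a * p]; the rest is a partial sum
   times [a]. *)
- have /(cvgn_mull (b := a)) : (fun n => series u n.+1) @ \oo --> s.
    by rewrite cvg_shiftS.
  move=> aus; apply: (cvgn_unique aus).
  under eq_fun do rewrite /series/= big_nat_recl// mulrDr au0 mulr_sumr
    (eq_bigr _ (fun n _ => auS n)) -mulr_suml.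
  by apply: cvgD; [exact: cvg_cst|exact: cvgn_mulr].
Qed.

(** * Passing between group inverses and idempotents *)

Lemma mul_fix_compl x y : (1 - x) * y = 0 -> x * y = y.
Proof. by rewrite mulrBl mul1r => /subr0_eq. Qed.

Lemma compl_compress (a e : A) : e * e = e -> e * a = a * e ->
  (1 - e) * a * (1 - e) = (1 - e) * a.
Proof.
move=> ee ea; rewrite mulrBr mulr1 -[(1 - e) * a * e]mulrA -ea mulrA.
by rewrite [(1 - e) * e]mulrBl mul1r ee subrr mul0r subr0.
Qed.

Lemma gen_right_group_inverse_idem (a x : A) (m : nat) :
  gen_right_group_inverse m a x ->
  let q := a * x in
  [/\ q * q = q, q * a * q = a * q, q * x = x,
      star (a ^+ m * q) * (a ^+ m * (1 - q)) = 0 & qnil (a * (1 - q))].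
Proof.
move=> [d [ad aad qd] [ax star_x x0]] q.
have b0 : root_norm_cvg0 (fun n => (1 - q) * a ^+ n).
  by apply: root_norm_cvg0_eqS x0 => n; rewrite mulrBl mul1r.
(* Decay of [(1 - q) * a ^+ n] forces [1 - q] to annihilate [a * x]; the same argument with
   [(1 - q) * a] yields [qaq]. *)
have qq : q * q = q by apply/mul_fix_compl/(root_norm_cvg0_annihil ax).
have qaq : q * a * q = a * q.
  rewrite -mulrA; apply/mul_fix_compl; rewrite mulrA.
  apply: (root_norm_cvg0_annihil ax).
  have := root_norm_cvg0_mul 1 a b0; apply: root_norm_cvg0_eqS => n.
  by rewrite mul1r -!mulrA -exprS -exprSr.
have qx : q * x = x by rewrite [RHS]ax /q expr2 mulrA.
split; [exact: qq|exact: qaq|exact: qx| |].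
(* The idempotent [e] commutes with [a] and fixes [q], so [a ^+ m * q] factors through [e]; the star
   condition on [x] then gives orthogonality. *)
- pose e := a * d.
  have ea : e * a = a * e by rewrite /e mulrA -expr2 aad.
  have ee : e * e = e by rewrite {2}/e mulrA ea -mulrA /e -mulrA -expr2 ad.
  have e0 : root_norm_cvg0 (fun n => (1 - e) * a ^+ n).
    apply/qnil_compress; last by rewrite mulrBl mul1r; exact: qd.
    exact: compl_compress ee ea.
  have eq : e * q = q by apply/mul_fix_compl/(root_norm_cvg0_annihil ax).
  have -> : a ^+ m * q = e * (a ^+ m * q).
    by rewrite mulrA (commrX m (ea : GRing.comm e a)) -mulrA eq.
  have e_perp : star e * (a ^+ m * (1 - q)) = 0.
    rewrite mulrBr mulr1 mulrBr -[X in X - _]star_x exprSr /q !mulrA.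
    by rewrite subrr.
  by rewrite star_mul -mulrA e_perp mulr0.
- apply: qnil_mulC; apply/qnil_compress; last exact: b0.
  rewrite mulrBr mulr1 mulrBl mul1r [(a - q * a) * q]mulrBl qaq subrr.
  by rewrite subr0.
Qed.

(* In block form with respect to [q + p = 1] one has [a = [a1, a2; 0, a4]] with
   [a1] right invertible and [a4] quasinilpotent; [e = [1, s; 0, 0]] commutes
   with [a] exactly when [s] solves the Sylvester equation. *)
Lemma gen_right_group_inverse_of_idem (a c p q : A) (m : nat) : (1 <= m)%N ->
  p * p = p -> q + p = 1 -> q * c = c -> c * q = c -> a * c = q ->
  p * a * q = 0 -> star (a ^+ m * q) * (a ^+ m * p) = 0 -> qnil (a * p) ->
  gen_right_group_inverse m a c.
Proof.
move=> m0 pp qp qc cq ac paq star_p ap0.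
have qE : q = 1 - p by rewrite -qp addrK.
have pE : p = 1 - q by rewrite -qp addrC addKr.
have qq : q * q = q.
  by rewrite qE mulrBl mul1r mulrBr mulr1 pp subrr subr0.
have pq : p * q = 0 by rewrite qE mulrBr mulr1 pp subrr.
have paE : p * a * p = p * a by rewrite -[RHS]mulr1 -qp mulrDr paq add0r.
have pa0 : root_norm_cvg0 (fun n => p * a ^+ n).
  by apply/(qnil_compress paE)/qnil_mulC.
have aq : a * q = q * a * q.
  by rewrite -[LHS]mul1r -qp mulrDl !mulrA paq addr0.
have [s [qs sp sylv]] := sylvester_solution ac qc pp qp paq pa0.
pose e := q + s; pose d := c * e.
have eq : e * q = q by rewrite mulrDl qq -sp -mulrA pq mulr0 addr0.
have qe : q * e = e by rewrite mulrDr qq qs.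
have ee : e * e = e by rewrite -{2}qe mulrA eq qe.
have ea : e * a = a * e.
  by rewrite mulrDr sylv addrA aq -mulrDr qp mulr1 mulrDl.
have ad : a * d = e by rewrite mulrA ac qe.
have qd : q * d = d by rewrite mulrA qc.
have add : a * d ^+ 2 = d by rewrite expr2 mulrA ad /d mulrA -qc mulrA eq.
exists d.
  split; [exact: add|by rewrite expr2 -mulrA ad ea|].
  rewrite ad -[X in X - _]mul1r -mulrBl; apply/qnil_compress.
    exact: compl_compress ee ea.
  (* As [e * q = q], one has [1 - e = (1 - e) * p], so the decay of [p * a ^+ n] carries over. *)
  have := root_norm_cvg0_mul (1 - e) 1 pa0; apply: root_norm_cvg0_eqS => n.
  rewrite mulr1 mulrA; congr (_ * _).
  by rewrite pE mulrBr mulr1 mulrBl mul1r eq subrr subr0.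
split; first by rewrite expr2 mulrA ac.
(* This exposes [star (a ^+ m * q)] inside [star (a * d)]. Writing [m = k + 1] provides a factor [d]
   on which [q] acts as the identity. *)
- have -> : a * d = a ^+ m * q * d ^+ m.
    case: m m0 {star_p} => // k _; rewrite -(mul_expr_fix k (esym add)).
    have qdX : q * d ^+ k.+1 = d ^+ k.+1 by rewrite exprS mulrA qd.
    by rewrite -[RHS]mulrA qdX mulrA -exprSr.
  rewrite -mulrA exprSr -[a ^+ m * a * c]mulrA ac star_mul.
  apply/esym/subr0_eq; rewrite -mulrBr -mulrA.
  by rewrite -[X in X - _]mulr1 -mulrBr -pE star_p mulr0.
- by apply: root_norm_cvg0_eqS pa0 => n; rewrite ac pE mulrBl mul1r.
Qed.

End RootNorm.

Theorem theorem3p5 (R : realType) (A : banachStarAlgType R) (a : A) (m : nat)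
    (hm : (1 <= m)%N) :
  (exists x : A, gen_right_group_inverse m a x) <->
  (exists p : A,
    p * p = p /\
    corner_right_invertible (1 - p) ((1 - p) * a * (1 - p)) /\
    star (star (a ^+ m) * a ^+ m * p) = star (a ^+ m) * a ^+ m * p /\
    qnil (a * p) /\
    right_ideal (1 - p) = right_ideal (a * (1 - p))).
Proof.
split=> [[x ax]|[p [pp [[_ [c [z _ qzq] qaqc]] [star_p [ap0 idealE]]]]]].
- have [qq qaq qx star_q aq0] := gen_right_group_inverse_idem ax.
  set q := a * x in qq qaq qx star_q aq0.
  have aqx : a * q * x = q by rewrite -mulrA qx.
  have pp : (1 - q) * (1 - q) = 1 - q.
    by rewrite mulrBr mulr1 mulrBl mul1r qq subrr subr0.
  exists (1 - q); rewrite subKr; split=> //; split.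
    split; first by exists a.
    exists (q * x * q); first by exists x.
    by rewrite qaq qx mulrA aqx qq.
  split; first by apply/star_gram_idem; rewrite ?subKr.
  split=> //; apply/seteqP; split=> _ [z _ <-].
    by exists (x * z) => //; rewrite mulrA aqx.
  by exists (a * q * z) => //; rewrite mulrA [q * (a * q)]mulrA qaq.
- set q := 1 - p in qzq qaqc idealE.
  have qq : q * q = q by rewrite /q mulrBr mulr1 mulrBl mul1r pp subrr subr0.
  (* The equality of ideals puts [a * q] in [q A]; hence the corner inverse [c] satisfies
     [a * c = q] without compression. *)
  have qaq : q * a * q = a * q.
    have : right_ideal (a * q) (a * q) by exists 1 => //; rewrite mulr1.
    by rewrite -idealE => -[y _ qy]; rewrite -mulrA -qy mulrA qq.
  have qc : q * c = c by rewrite -qzq !mulrA qq.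
  have cq : c * q = c by rewrite -qzq -mulrA qq.
  have ac : a * c = q by rewrite -{1}qc mulrA -qaq.
  exists c; apply: (@gen_right_group_inverse_of_idem _ _ a c p q) => //.
  + by rewrite /q subrK.
  + by rewrite -[p](subKr 1) -/q mulrBl mul1r mulrBl qaq subrr.
  + exact/star_gram_idem.
Qed.
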